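(* Let $G_3=\langle a,b,c\mid [a,b]c^2=1\rangle$, where $[a,b]=aba^{-1}b^{-1}$ (the fundamental group of the closed non-orientable surface of genus $3$). Then the free subgroup $H=\langle a,b\rangle$ is not hyperbolically embedded in $G_3$ with respect to any relative generating set; that is, there is no subset $X\subseteq G_3$ with $H\hookrightarrow_h(G_3,X)$.
   Context: Let $G$ be a group, $H\leq G$, $X\subseteq G$ with $G=\langle X\cup H\rangle$. $\Gamma(G,X\sqcup H)$ is the Cayley graph of $G$ with respect to the disjoint union alphabet $X\sqcup H$ (labels from $X$ and $H$ are distinguished even if they represent the same element), with edges of length one which may be traversed in either direction. $\Gamma(H,H)$ is the subgraph with vertex set $H$ and all $H$-labelled edges between vertices of $H$. A path in $\Gamma(G,X\sqcup H)$ is admissible if it uses no edge of $\Gamma(H,H)$. For $h,k\in H$, $\hat d(h,k)$ is the minimum length of an admissible path from $h$ to $k$, or $\infty$ if none exists. One writes $H\hookrightarrow_h(G,X)$ if (a) $G=\langle X\cup H\rangle$ (i.e. $X$ is a relative generating set); (b) $\Gamma(G,X\sqcup H)$ is Gromov hyperbolic; (c) every ball of finite radius in $(H,\hat d)$ is finite. *)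

(* Defs.v *)
From HB Require Import structures.
From mathcomp Require Import all_boot all_order all_algebra.
From mathcomp Require Import all_classical all_reals ereal.
From Stdlib Require Import Relation_Operators.

Set Implicit Arguments.
Unset Strict Implicit.
Unset Printing Implicit Defensive.

Import Order.TTheory GRing.Theory Num.Theory.
Local Open Scope classical_set_scope.
Local Open Scope ring_scope.

(* A letter [(i, false)] stands for the generator [i], [(i, true)] for its
   inverse. *)
Definition word (I : Type) : Type := seq (I * bool).

Inductive word_step (I : Type) (rels : set (word I)) : word I -> word I -> Prop :=
| step_cancel u v i e :
    word_step rels (u ++ (i, e) :: (i, ~~ e) :: v) (u ++ v)
| step_relator u v r : rels r -> word_step rels (u ++ r ++ v) (u ++ v).

Definition word_eq (I : Type) (rels : set (word I)) : word I -> word I -> Prop :=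
  clos_refl_sym_trans (word I) (word_step rels).

Definition word_inv (I : Type) (w : word I) : word I :=
  rev [seq (l.1, ~~ l.2) | l <- w].

Section WordEq.
Variables (I : Type) (rels : set (word I)).
Local Notation "u ~ v" := (word_eq rels u v) (at level 70).

Lemma word_eq_ctx p q u v : u ~ v -> p ++ u ++ q ~ p ++ v ++ q.
Proof.
elim=> [x y [u1 v1 i e|u1 v1 r rr]|x|x y _|x y z _ xy _].
- by rewrite -!catA !(catA p); apply/rst_step/step_cancel.
- by rewrite -!catA !(catA p); apply/rst_step/step_relator.
- exact: rst_refl.
- exact: rst_sym.
- exact: rst_trans xy.
Qed.

Lemma word_eq_cat u u' v v' : u ~ u' -> v ~ v' -> u ++ v ~ u' ++ v'.
Proof.
move=> /(@word_eq_ctx [::] v) /= uu' /(@word_eq_ctx u' [::]).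
by rewrite !cats0; apply: rst_trans uu'.
Qed.

Lemma word_invK : involutive (@word_inv I).
Proof.
move=> w; rewrite /word_inv map_rev revK -map_comp.
by rewrite -[RHS]map_id; apply: eq_map => -[i e] /=; rewrite negbK.
Qed.

Lemma word_catV w : w ++ word_inv w ~ [::].
Proof.
elim: w => [|[i e] w IHw]; first exact: rst_refl.
rewrite /word_inv /= rev_cons -cats1 catA.
apply: rst_trans (@word_eq_ctx [:: (i, e)] [:: (i, ~~ e)] _ _ IHw) _.
exact/rst_step/(@step_cancel _ _ [::] [::]).
Qed.

Lemma word_catVl w : word_inv w ++ w ~ [::].
Proof. by rewrite -{2}[w]word_invK; apply: word_catV. Qed.

Lemma word_eq_inv u v : u ~ v -> word_inv u ~ word_inv v.
Proof.
move=> uv; apply: (@rst_trans _ _ _ (word_inv u ++ v ++ word_inv v)).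
  rewrite -{1}[word_inv u]cats0; apply: word_eq_cat; first exact: rst_refl.
  exact/rst_sym/word_catV.
rewrite catA -{2}[word_inv v]cat0s; apply: word_eq_cat; last exact: rst_refl.
apply: rst_trans (word_catVl u); apply: word_eq_cat; first exact: rst_refl.
exact: rst_sym.
Qed.

End WordEq.

Section Presented.
Variables (I : choiceType) (rels : set (word I)).

Definition word_eqb : rel (word I) := fun u v => `[< word_eq rels u v >].

Fact word_eqb_refl : reflexive word_eqb.
Proof. by move=> u; apply/asboolP/rst_refl. Qed.
Fact word_eqb_sym : symmetric word_eqb.
Proof. by move=> u v; apply/asboolP/asboolP; apply: rst_sym. Qed.
Fact word_eqb_trans : transitive word_eqb.
Proof. by move=> v u w /asboolP uv /asboolP vw; apply/asboolP/(rst_trans _ _ _ v). Qed.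

Canonical word_eqb_equiv :=
  EquivRel word_eqb word_eqb_refl word_eqb_sym word_eqb_trans.

(* The group < I | rels >. *)
Definition presented := {eq_quot word_eqb}%qT.
HB.instance Definition _ := Choice.on presented.

Definition pclass (w : word I) : presented := (\pi_({eq_quot word_eqb}) w)%qT.
Definition prepr (x : presented) : word I := repr x.

Lemma preprK : cancel prepr pclass.
Proof. by move=> x; apply: reprK. Qed.

Lemma pclassP u v : pclass u = pclass v <-> word_eq rels u v.
Proof.
rewrite /pclass; split=> [/eqmodP/asboolP //|uv].
exact/eqmodP/asboolP.
Qed.

Lemma pclassK u : word_eq rels (prepr (pclass u)) u.
Proof. exact/pclassP/preprK. Qed.

Definition pmul (x y : presented) : presented := pclass (prepr x ++ prepr y).
Definition pone : presented := pclass [::].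
Definition pinv (x : presented) : presented := pclass (word_inv (prepr x)).

Fact pmulA : associative pmul.
Proof.
move=> x y z; apply/pclassP.
apply: (@rst_trans _ _ _ (prepr x ++ prepr y ++ prepr z)).
  by apply: word_eq_cat; [exact: rst_refl | exact: pclassK].
by rewrite catA; apply: word_eq_cat; [exact/rst_sym/pclassK | exact: rst_refl].
Qed.

Fact pmul1 : left_id pone pmul.
Proof.
move=> x; rewrite -[RHS]preprK; apply/pclassP; rewrite -[X in word_eq _ _ X]cat0s.
by apply: word_eq_cat; [exact: pclassK | exact: rst_refl].
Qed.

Fact pmulr1 : right_id pone pmul.
Proof.
move=> x; rewrite -[RHS]preprK; apply/pclassP; rewrite -[X in word_eq _ _ X]cats0.
by apply: word_eq_cat; [exact: rst_refl | exact: pclassK].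
Qed.

Fact pmulV : left_inverse pone pinv pmul.
Proof.
move=> x; apply/pclassP; apply: rst_trans (word_catVl rels (prepr x)).
by apply: word_eq_cat; [exact: pclassK | exact: rst_refl].
Qed.

Fact pmulrV : right_inverse pone pinv pmul.
Proof.
move=> x; apply/pclassP; apply: rst_trans (word_catV rels (prepr x)).
by apply: word_eq_cat; [exact: rst_refl | exact: pclassK].
Qed.

HB.instance Definition _ :=
  isGroup.Build presented pmulA pmul1 pmulr1 pmulV pmulrV.

Definition pgen (i : I) : presented := pclass [:: (i, false)].

End Presented.

Section Subgroups.
Variable G : groupType.
Local Open Scope group_scope.

Definition is_subgroup (A : set G) : Prop :=
  A 1 /\ forall x y, A x -> A y -> A (x / y).

Definition gen (A : set G) : set G := smallest is_subgroup A.

Definition word_eval (I : Type) (f : I -> G) (w : word I) : G :=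
  \prod_(l <- w) (if l.2 then (f l.1)^-1 else f l.1).

(* The homomorphism from the free group on [I] sending [i] to [f i] is
   injective; words representing the identity of that group are those that are
   equivalent to the empty word when there are no relators. *)
Definition free_family (I : Type) (f : I -> G) : Prop :=
  forall w : word I, word_eval f w = 1 -> word_eq set0 w [::].

End Subgroups.

(* [d] is a possibly infinite pseudometric; points at distance 0 are regarded as
   equal. *)
Section Hyperbolic.
Variables (R : realType) (P : Type) (d : P -> P -> \bar R).

Definition geodesic (x y : P) (L : R) (gamma : R -> P) : Prop :=
  [/\ 0 <= L, d (gamma 0) x = 0%E, d (gamma L) y = 0%E &
      forall s t, 0 <= s <= L -> 0 <= t <= L ->
        d (gamma s) (gamma t) = `|s - t|%:E].

Definition near_side (delta : R) (p : P) (L : R) (gamma : R -> P) : Prop :=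
  exists2 t, 0 <= t <= L & (d p (gamma t) <= delta%:E)%E.

(* Geodesic triangles are uniformly slim. Only the side from [x] to [y] is
   mentioned, as the three sides are permuted cyclically. *)
Definition gromov_hyperbolic : Prop :=
  exists2 delta : R, 0 <= delta &
    forall (x y z : P) (L1 L2 L3 : R) (g1 g2 g3 : R -> P),
      geodesic x y L1 g1 -> geodesic y z L2 g2 -> geodesic z x L3 g3 ->
      forall s, 0 <= s <= L1 ->
        near_side delta (g1 s) L2 g2 \/ near_side delta (g1 s) L3 g3.

End Hyperbolic.

Section Cayley.
Variables (R : realType) (G : groupType) (X H : set G).
Local Open Scope group_scope.

Definition alphabet : Type := (set_type X + set_type H)%type.

Definition letter_val (l : alphabet) : G :=
  match l with inl x => val x | inr h => val h end.

(* [(g, l)] is the edge labelled [l] from [g] to [g * letter_val l]. *)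
Definition edge : Type := (G * alphabet)%type.
Definition edge_end (e : edge) (b : bool) : G :=
  if b then e.1 * letter_val e.2 else e.1.

(* [(e, true)] is [e] traversed backwards. *)
Definition arc : Type := (edge * bool)%type.
Definition arc_src (a : arc) : G := edge_end a.1 a.2.
Definition arc_tgt (a : arc) : G := edge_end a.1 (~~ a.2).

Fixpoint is_path (x : G) (p : seq arc) (y : G) : Prop :=
  if p is a :: p' then arc_src a = x /\ is_path (arc_tgt a) p' y else x = y.

(* The edges of the subgraph Gamma(H, H). *)
Definition in_HH (e : edge) : Prop :=
  [/\ (if e.2 is inr _ then True else False),
      H (edge_end e false) & H (edge_end e true)].

Fixpoint admissible (p : seq arc) : Prop :=
  if p is a :: p' then ~ in_HH a.1 /\ admissible p' else True.

Definition min_length (S : set (seq arc)) : \bar R :=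
  ereal_inf [set ((size p)%:R)%:E | p in S].

Definition graph_dist (x y : G) : \bar R := min_length [set p | is_path x p y].

Definition hat_d (h k : G) : \bar R :=
  min_length [set p | is_path h p k /\ admissible p].

(* The geometric realization, in which every edge is a copy of [0, 1]:
   [(e, t)] is the point of [e] at parameter [t] from its initial vertex. Since
   [H] is nonempty, every vertex lies on some edge. *)
Definition rpoint : Type := (edge * {i01 R})%type.
Definition rpoint_off (p : rpoint) (b : bool) : R :=
  (if b then 1 - p.2%:num else p.2%:num)%R.

(* Shortest way from [p] to [q], either through an end of each edge, or inside
   a common edge. *)
Definition realization_dist (p q : rpoint) : \bar R :=
  ereal_inf
    ([set ((rpoint_off p bc.1)%:E
           + graph_dist (edge_end p.1 bc.1) (edge_end q.1 bc.2)
           + (rpoint_off q bc.2)%:E)%E | bc in [set: bool * bool]]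
     `|` [set r | p.1 = q.1 /\ r = (`|p.2%:num - q.2%:num|%R)%:E]).

Definition hyp_embedded : Prop :=
  [/\ gen (X `|` H) = [set: G],
      gromov_hyperbolic realization_dist &
      forall (h : G) (r : R), H h ->
        finite_set [set k | H k /\ (hat_d h k <= r%:E)%E]].

End Cayley.

Definition ia : 'I_3 := @Ordinal 3 0 isT.
Definition ib : 'I_3 := @Ordinal 3 1 isT.
Definition ic : 'I_3 := @Ordinal 3 2 isT.

Definition relator3 : word 'I_3 :=
  [:: (ia, false); (ib, false); (ia, true); (ib, true); (ic, false); (ic, false)].

Definition G3 : groupType := presented [set relator3].
Definition a3 : G3 := pgen [set relator3] ia.
Definition b3 : G3 := pgen [set relator3] ib.
Definition c3 : G3 := pgen [set relator3] ic.

(* Main.v *)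
(* A hyperbolically embedded subgroup H is almost malnormal.  Let g lie outside
   H and let p be an admissible path from some k0 in H to g, of length n.  If h
   and g^-1 h g both lie in H, then p, the H-edge from g to h g, and the reverse
   of h p form an admissible path from k0 to h k0 of length 2n + 1; local
   finiteness of (H, hat d) leaves only finitely many such h.  In G3 this fails
   for g = c, as c commutes with the powers of c^2 = [a,b]^-1, which lie in H.

   Both freeness of H and the infinite order of c^2 come from doubling: an action
   of the free group on T extends to an action of G3 on two copies of T, in which
   c swaps the copies, multiplying by [b,a] on the way back.  The generator c is
   not in H because H preserves each copy. *)
Require Import Defs.
From mathcomp Require Import all_boot all_order all_algebra.
From mathcomp Require Import all_classical all_reals.
From mathcomp Require Import ereal.
From Stdlib Require Import Relation_Operators.

Local Open Scope classical_set_scope.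

Set Implicit Arguments.
Unset Strict Implicit.
Unset Printing Implicit Defensive.

Import GRing.Theory Num.Theory.

(** * Closure properties of subgroups *)

Section Subgroup.
Variables (G : groupType) (H : set G).
Hypothesis subgroup_H : is_subgroup H.
Local Open Scope group_scope.

Lemma is_subgroup1 : H 1. Proof. by case: subgroup_H. Qed.

Lemma is_subgroupV x : H x -> H x^-1.
Proof.
by move=> Hx; rewrite -[x^-1]mul1g; apply: (proj2 subgroup_H) => //; exact: is_subgroup1.
Qed.

Lemma is_subgroupM x y : H x -> H y -> H (x * y).
Proof.
by move=> Hx Hy; rewrite -[y]invgK; apply: (proj2 subgroup_H) => //; exact: is_subgroupV.
Qed.

Lemma is_subgroupX x n : H x -> H (x ^+ n).
Proof.
move=> Hx; elim: n => [|n IHn]; first exact: is_subgroup1.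
by rewrite expgS; apply: is_subgroupM.
Qed.

Lemma is_subgroupMl x y : H x -> H (x * y) -> H y.
Proof. by move=> Hx Hxy; rewrite -(mulKg x y); apply: is_subgroupM => //; exact: is_subgroupV. Qed.

End Subgroup.

Lemma gen_subgroup (G : groupType) (A : set G) : is_subgroup (gen A).
Proof.
split=> [B [[B1 _] _] //|x y Ax Ay B sAB].
by apply: (proj2 sAB.1); [exact: Ax | exact: Ay].
Qed.

(** * Paths in the Cayley graph and almost malnormality *)

Section CayleyPaths.
Variables (G : groupType) (X H : set G).
Local Open Scope group_scope.
Local Notation arc := (Defs.arc X H).

Definition arc_rev (a : arc) : arc := (a.1, ~~ a.2).
Definition path_rev (p : seq arc) : seq arc := rev (map arc_rev p).

Definition arc_translate (h : G) (a : arc) : arc := ((h * a.1.1, a.1.2), a.2).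
Definition path_translate (h : G) (p : seq arc) : seq arc := map (arc_translate h) p.

Lemma is_path_cat (p q : seq arc) x y z :
  is_path x p y -> is_path y q z -> is_path x (p ++ q) z.
Proof.
elim: p x => [|a p IHp] x /=; first by move->.
by move=> [ax py] qz; split=> //; apply: IHp.
Qed.

Lemma is_path_rev (p : seq arc) x y : is_path x p y -> is_path y (path_rev p) x.
Proof.
elim: p x => [|a p IHp] x /=; first by move->.
move=> [ax /IHp pr]; rewrite /path_rev /= rev_cons -cats1.
by apply: is_path_cat pr _; rewrite /= /arc_tgt /arc_src /= negbK.
Qed.

Lemma admissible_cat (p q : seq arc) :
  admissible p -> admissible q -> admissible (p ++ q).
Proof. by elim: p => [//|a p IHp] /= [na ap] aq; split=> //; apply: IHp. Qed.

Lemma admissible_rev (p : seq arc) : admissible p -> admissible (path_rev p).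
Proof.
elim: p => [//|a p IHp] /= [na ap]; rewrite /path_rev /= rev_cons -cats1.
by apply: admissible_cat; [exact: IHp | split].
Qed.

Lemma edge_end_translate h (a : arc) b :
  edge_end (arc_translate h a).1 b = h * edge_end a.1 b.
Proof. by case: b => //=; rewrite /edge_end /= mulgA. Qed.

Lemma is_path_translate h (p : seq arc) x y :
  is_path x p y -> is_path (h * x) (path_translate h p) (h * y).
Proof.
elim: p x => [|a p IHp] x /=; first by move->.
move=> [<- pa]; rewrite /arc_src /arc_tgt !edge_end_translate; split=> //.
exact: IHp.
Qed.

(** For h in [H], a vertex v lies in [H] as soon as h v does, so an edge translated into Gamma(H, H)
    was there already. *)
Lemma admissible_translate h (p : seq arc) :
  is_subgroup H -> H h -> admissible p -> admissible (path_translate h p).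
Proof.
move=> sH Hh; elim: p => [//|a p IHp] /= [na ap]; split; last exact: IHp.
move=> [lab H0 H1]; apply: na; split=> //; apply: (is_subgroupMl sH Hh).
  by rewrite -edge_end_translate.
by rewrite -edge_end_translate.
Qed.

(** The elements g such that every z is joined to z g form a subgroup containing [X] and [H]. *)
Lemma Cayley_connected :
  gen (X `|` H) = [set: G] -> forall x y, exists p : seq arc, is_path x p y.
Proof.
move=> genXH x y.
have xyP : gen (X `|` H) (x^-1 * y) by rewrite genXH.
have [|p px] := xyP [set g | forall z, exists p : seq arc, is_path z p (z * g)] _ x.
  split; first split.
  - by move=> z; exists [::]; rewrite /= mulg1.
  (* Dividing by k means running backwards along a path from z g k^-1 to z g. *)
  - move=> g k gP kP z; have [p pz] := gP z; have [q qz] := kP (z * g * k^-1).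
    exists (p ++ path_rev q); apply: is_path_cat pz _.
    by rewrite mulgA; apply: is_path_rev; rewrite mulgVK in qz.
  - move=> g [Xg|Hg] z.
      by exists [:: ((z, inl (SigSub (mem_set Xg))), false)].
    by exists [:: ((z, inr (SigSub (mem_set Hg))), false)].
by rewrite mulVKg in px; exists p.
Qed.

(* Cut the path at its last vertex in [H]. *)
Lemma path_trim (p : seq arc) x g : ~ H g -> is_path x p g ->
  (exists h (q : seq arc), [/\ H h, is_path h q g & admissible q]) \/ (~ H x /\ admissible p).
Proof.
move=> nHg; elim: p x => [|a p IHp] x /=; first by move=> ->; right.
move=> [ax pg]; have [|[nHt ap]] := IHp _ pg; first by left.
(* The target of [a] lies outside [H], which rules out Gamma(H, H). *)
have na : ~ in_HH a.1 by move=> [_ H0 H1]; apply: nHt; rewrite /arc_tgt; case: (~~ _).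
have [Hx|nHx] := pselect (H x); last by right.
by left; exists x, (a :: p).
Qed.

Lemma hat_d_le (R : realType) (p : seq arc) h k :
  is_path h p k -> admissible p -> (hat_d R X H h k <= ((size p)%:R)%:E)%E.
Proof. by move=> pk ap; apply: ereal_inf_lbound; exists p. Qed.

Theorem hyp_embedded_almost_malnormal (R : realType) (g : G) :
  is_subgroup H -> hyp_embedded R X H -> ~ H g ->
  finite_set [set h | H h /\ H (h ^ g)].
Proof.
move=> sH [genXH _ finH] nHg.
have [p0 p0g] := Cayley_connected genXH 1 g.
(* The path starts at 1, which lies in [H], so the second alternative is impossible. *)
have [[k0 [p [Hk0 pg ap]]]|[]] := path_trim nHg p0g; last first.
  by move=> nH1; case: nH1; exact: is_subgroup1.
pose r : R := ((size p + (1 + size p))%:R)%R.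
(* The ball of radius [r] about [k0] is pulled back along the injection h |-> h k0. *)
apply: sub_finite_set (@finite_preimage _ _ _ (fun h => h * k0) _ (finH k0 r Hk0)).
- move=> h [Hh Hhg] /=; split; first exact: is_subgroupM.
  pose a : arc := ((g, inr (SigSub (mem_set Hhg))), false).
  pose q := p ++ a :: path_rev (path_translate h p).
  have -> : r = ((size q)%:R)%R by rewrite /q size_cat /= size_rev !size_map.
  apply: hat_d_le.
    apply: (is_path_cat pg); split; first by [].
    have -> : arc_tgt a = h * g by rewrite /arc_tgt /edge_end /= conjgE mulVKg.
    exact/is_path_rev/is_path_translate.
  (* The edge [a] starts at g, outside [H], so it is not in Gamma(H, H). *)
  apply: (admissible_cat ap); split; first by case.
  exact/admissible_rev/admissible_translate.
- by move=> x y _ _; apply: mulIg.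
Qed.

End CayleyPaths.

(** * Actions of presented groups, defined on words *)

Section WordAction.
Variables (I S : Type) (f : I -> bool -> S -> S).

(** [f i e] is the action of the letter [(i, e)]. The rightmost letter acts first, which gives a
    left action. *)
Definition word_act (w : word I) (s : S) : S := foldr (fun l => f l.1 l.2) s w.

Lemma word_act_cat u v s : word_act (u ++ v) s = word_act u (word_act v s).
Proof. exact: foldr_cat. Qed.

Lemma word_act_eq (rels : set (word I)) :
  (forall i e, cancel (f i (~~ e)) (f i e)) ->
  (forall r, rels r -> word_act r =1 id) ->
  forall u v, word_eq rels u v -> word_act u =1 word_act v.
Proof.
move=> fK fr u v; elim=> {u v} [x y [u v i e|u v r rr]|x|x y _ xy|x y z _ xy _ yz] s.
- by rewrite !word_act_cat /= fK.
- by rewrite !word_act_cat (fr _ rr).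
- by [].
- by rewrite xy.
- by rewrite xy.
Qed.

End WordAction.

Section PresentedTheory.
Variables (I : choiceType) (rels : set (word I)).
Local Open Scope group_scope.
Local Notation pclass := (@pclass I rels).

Lemma pclass_cat u v : pclass (u ++ v) = pclass u * pclass v.
Proof. by apply/pclassP; apply: word_eq_cat; apply/rst_sym/pclassK. Qed.

Lemma pgenV i : (pgen rels i)^-1 = pclass [:: (i, true)].
Proof.
apply: mulg1_eq; rewrite -pclass_cat.
exact/pclassP/rst_step/(@step_cancel _ _ [::] [::]).
Qed.

(** This turns the group products in [free_family] into classes of words; [k] renames letters, so
    that words in two letters can be read in G3. *)
Lemma word_eval_pgen (J : Type) (k : J -> I) (w : word J) :
  word_eval (fun j => pgen rels (k j)) w = pclass [seq (k l.1, l.2) | l <- w].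
Proof.
rewrite /word_eval; elim: w => [|[j e] w IHw]; first by rewrite big_nil.
by rewrite big_cons IHw /= -cat1s pclass_cat; case: e => /=; rewrite ?pgenV.
Qed.

Lemma pclass_relator r : rels r -> pclass r = 1.
Proof.
move=> rr; apply/pclassP/rst_step.
by have := @step_relator _ rels [::] [::] r rr; rewrite cats0.
Qed.

Section Action.
Variables (S : Type) (f : I -> bool -> S -> S).
Hypothesis fK : forall i e, cancel (f i (~~ e)) (f i e).
Hypothesis f_rels : forall r, rels r -> word_act f r =1 id.

Definition presented_act (x : presented rels) : S -> S := word_act f (prepr x).

Lemma presented_act_pclass w : presented_act (pclass w) =1 word_act f w.
Proof. exact/(word_act_eq fK f_rels)/pclassK. Qed.

Lemma presented_act1 s : presented_act 1 s = s.
Proof. by rewrite presented_act_pclass. Qed.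

Lemma presented_actM x y s :
  presented_act (x * y) s = presented_act x (presented_act y s).
Proof. by rewrite presented_act_pclass word_act_cat. Qed.

Lemma presented_actX x n s : presented_act (x ^+ n) s = iter n (presented_act x) s.
Proof.
elim: n => [|n IHn]; first exact: presented_act1.
by rewrite expgS presented_actM IHn.
Qed.

End Action.

End PresentedTheory.

(** * Doubling: from actions of the free group to actions of G3 *)

Section Doubling.
Variables (T : Type) (f : bool -> bool -> T -> T).
Hypothesis fK : forall i e, cancel (f i (~~ e)) (f i e).

(** In [f i e], [i] is [false] for a and [true] for b, and [e] marks an inverse. With this reading
    [comm_ab] is the action of [a,b] and [comm_ba] that of [b,a]. *)
Definition comm_ab (t : T) : T :=
  f false false (f true false (f false true (f true true t))).
Definition comm_ba (t : T) : T :=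
  f true false (f false false (f true true (f false true t))).

Lemma comm_abK : cancel comm_ab comm_ba.
Proof.
move=> t; rewrite /comm_ba /comm_ab.
by rewrite (@fK false true) (@fK true true) (@fK false false) (@fK true false).
Qed.

Lemma comm_baK : cancel comm_ba comm_ab.
Proof.
move=> t; rewrite /comm_ba /comm_ab.
by rewrite (@fK true true) (@fK false true) (@fK true false) (@fK false false).
Qed.

(** The last case is c: it sends (t, false) to (t, true) and (t, true) to ([b,a] t, false). Its
    square is then [b,a] on both copies, as the relator demands. *)
Definition double (i : 'I_3) (e : bool) (s : T * bool) : T * bool :=
  match nat_of_ord i with
  | 0 => (f false e s.1, s.2)
  | 1 => (f true e s.1, s.2)
  | _ => if e then (if s.2 then (s.1, false) else (comm_ab s.1, true))
         else (if s.2 then (comm_ba s.1, false) else (s.1, true))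
  end.

Lemma doubleK i e : cancel (double i (~~ e)) (double i e).
Proof.
rewrite /double; case: i => [[|[|i]] lti] [t k] /=; rewrite ?fK //.
by case: e; case: k; rewrite /= ?comm_abK ?comm_baK.
Qed.

Lemma double_relator3 r : [set relator3] r -> word_act double r =1 id.
Proof.
move=> -> [t k].
have -> : word_act double relator3 (t, k) = (comm_ab (comm_ba t), k) by case: k.
by rewrite comm_baK.
Qed.

Definition G3_act : G3 -> T * bool -> T * bool := presented_act double.

Local Open Scope group_scope.

Lemma G3_actE w : G3_act (pclass [set relator3] w) =1 word_act double w.
Proof. exact: presented_act_pclass doubleK double_relator3 w. Qed.

Lemma G3_act1 s : G3_act 1 s = s.
Proof. exact: presented_act1 doubleK double_relator3 s. Qed.

Lemma G3_actM x y s : G3_act (x * y) s = G3_act x (G3_act y s).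
Proof. exact: presented_actM doubleK double_relator3 x y s. Qed.

Lemma G3_actX x n s : G3_act (x ^+ n) s = iter n (G3_act x) s.
Proof. exact: presented_actX doubleK double_relator3 x n s. Qed.

Lemma G3_act_gen_ab x s : gen [set a3; b3] x -> (G3_act x s).2 = s.2.
Proof.
move=> genx; move: s.
apply: (genx [set x | forall s, (G3_act x s).2 = s.2]); split; first split.
- by move=> s; rewrite G3_act1.
(* For the inverse of z, the hypothesis on z is used at the point z^-1 s. *)
- move=> y z /= yP zP s; rewrite G3_actM yP -[LHS]zP -G3_actM.
  by rewrite mulgV G3_act1.
- by move=> _ [->|->] s; rewrite G3_actE.
Qed.

Lemma G3_act_c3 t : G3_act c3 (t, false) = (t, true).
Proof. by rewrite G3_actE. Qed.

Lemma G3_act_c3_sqr t k : G3_act (c3 ^+ 2) (t, k) = (comm_ba t, k).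
Proof. by rewrite expg2 G3_actM !G3_actE; case: k. Qed.

Lemma word_act_double w t k :
  word_act double [seq (if l.1 then ib else ia, l.2) | l <- w] (t, k) =
  (word_act f w t, k).
Proof. by elim: w => [//|[[] e] w IHw] /=; rewrite IHw. Qed.

End Doubling.

(** * Freeness of H from the doubled regular action *)

Section FreeRegular.
Local Open Scope group_scope.
Let F := presented (set0 : set (word bool)).

Definition free_regular (i e : bool) (x : F) : F := pclass set0 [:: (i, e)] * x.

Lemma free_regularK i e : cancel (free_regular i (~~ e)) (free_regular i e).
Proof.
move=> x; rewrite /free_regular mulgA -pclass_cat /=.
have -> : pclass set0 [:: (i, e); (i, ~~ e)] = 1 :> F.
  exact/pclassP/rst_step/(@step_cancel _ _ [::] [::]).
exact: mul1g.
Qed.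

Lemma word_act_free_regular w : word_act free_regular w 1 = pclass set0 w.
Proof.
by elim: w => [//|[i e] w IHw] /=; rewrite IHw /free_regular -pclass_cat.
Qed.

(** In the doubled regular action a word w in a and b sends (1, false) to (w, false). If w is
    trivial in G3 this point is fixed, so w is trivial in the free group. *)
Lemma free_family_a3b3 : free_family (fun i : bool => if i then b3 else a3).
Proof.
move=> w w1; apply/pclassP.
have eqf : (fun i : bool => if i then b3 else a3) =
    (fun i : bool => pgen [set relator3] (if i then ib else ia)).
  by apply/funext => -[].
move: w1; rewrite eqf word_eval_pgen => w1.
have := G3_actE free_regularK [seq (if l.1 then ib else ia, l.2) | l <- w] (1, false).
rewrite word_act_double word_act_free_regular w1 (G3_act1 free_regularK).
by case.
Qed.

End FreeRegular.

(* The action of the integral Heisenberg group on the plane, in which [b,a] is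
   the unit translation (x, y) |-> (x, y - 1). *)
Definition heisenberg_act (i e : bool) (t : int * int) : int * int :=
  if i then (if e then (t.1 - 1, t.2) else (t.1 + 1, t.2))%R
  else (if e then (t.1, t.2 - t.1) else (t.1, t.2 + t.1))%R.

Lemma heisenberg_actK i e :
  cancel (heisenberg_act i (~~ e)) (heisenberg_act i e).
Proof.
by case: i; case: e => -[x y]; rewrite /heisenberg_act /= ?addrK ?subrK.
Qed.

Lemma heisenberg_comm_ba x y :
  comm_ba heisenberg_act (x, y) = (x, y - 1)%R.
Proof.
rewrite /comm_ba /heisenberg_act /= subrK; congr (_, _).
by rewrite addrA subrK.
Qed.

(** * The element c violates almost malnormality *)

Section NotMalnormal.
Local Open Scope group_scope.

Lemma c3_notin_gen_ab : ~ gen [set a3; b3] c3.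
Proof.
move=> /(G3_act_gen_ab heisenberg_actK (0%R, 0%R, false)).
by rewrite (G3_act_c3 heisenberg_actK).
Qed.

Lemma c3_sqr_in_gen_ab : gen [set a3; b3] (c3 ^+ 2).
Proof.
have sH := gen_subgroup [set a3; b3].
have Ha : gen [set a3; b3] a3 by move=> B [_]; apply; left.
have Hb : gen [set a3; b3] b3 by move=> B [_]; apply; right.
have abc : a3 * b3 * a3^-1 * b3^-1 * c3 ^+ 2 = 1.
  have <- : pclass [set relator3] relator3 = 1 by exact: pclass_relator.
  (* Splitting the relator into single letters makes its class a product of generators and their
     inverses. *)
  rewrite !pgenV expg2 -[relator3]/([:: (ia, false)] ++ [:: (ib, false)]
    ++ [:: (ia, true)] ++ [:: (ib, true)] ++ [:: (ic, false)] ++ [:: (ic, false)]).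
  by rewrite !pclass_cat !mulgA.
rewrite -(mulg1_eq abc); apply: (is_subgroupV sH).
by do ![apply: (is_subgroupM sH) | apply: (is_subgroupV sH)].
Qed.

(** In the doubled Heisenberg action the n-th power of c^2 moves the origin of the first copy to (0,
    -n), so n can be read off. *)
Lemma expg_c3_sqr_inj : injective (fun n => (c3 ^+ 2) ^+ n).
Proof.
have act n : G3_act heisenberg_act ((c3 ^+ 2) ^+ n) (0%R, 0%R, false) =
    (0%R, (- n%:R)%R, false).
  rewrite (G3_actX heisenberg_actK).
  elim: n => [|n IHn] /=; first by rewrite oppr0.
  rewrite IHn (G3_act_c3_sqr heisenberg_actK) heisenberg_comm_ba.
  by rewrite -opprD natr1.
move=> m n /= mn; have := act m; rewrite mn act => -[].
by move=> /oppr_inj /eqP; rewrite eqr_nat => /eqP ->.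
Qed.

End NotMalnormal.

Theorem proposition4p7 (R : realType) :
  free_family (fun i : bool => if i then b3 else a3) /\
  ~ exists X : set G3, hyp_embedded R X (gen [set a3; b3]).
Proof.
split=> [|[X hypX]]; first exact: free_family_a3b3.
have sH := gen_subgroup [set a3; b3].
have := hyp_embedded_almost_malnormal sH hypX c3_notin_gen_ab.
(* Pulling the finite set back along n |-> (c^2)^n would make the natural numbers finite. *)
move=> /(finite_preimage (f := fun n => ((c3 ^+ 2) ^+ n)%g)) fin.
apply: infinite_nat; apply: sub_finite_set (fin _).
- move=> n _ /=; have Hn := is_subgroupX sH n c3_sqr_in_gen_ab.
  split=> //; suff -> : ((c3 ^+ 2 ^+ n) ^ c3 = c3 ^+ 2 ^+ n)%g by [].
  apply/conjg_fixP/commgP; rewrite -expgnA.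
  exact/commute_sym/commuteX/commute_refl.
- by move=> m n _ _; apply: expg_c3_sqr_inj.
Qed.
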